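(* Let $(G,P)$ be a quasi-lattice ordered group that admits a controlled map $\phi:(G,P)\to(\mathbb Z,\mathbb N)^\infty$. If $(G,P)$ is graph-irreducible, then the boundary spectrum $\partial\Omega$ coincides with the essential spectrum $\Omega_{\mathcal E}$. If, in addition, $P$ has infinitely many atoms, then $\partial\Omega=\Omega$, in which case the boundary quotient $C(\partial\Omega)\rtimes G$ coincides with the universal Toeplitz C*-algebra $C^*(G,P)$.
   Context: Groups are countable. A quasi-lattice ordered group $(G,P)$ is a group $G$ with a submonoid $P$ with $P\cap P^{-1}=\{e\}$ such that, for the left-invariant partial order $x\le y\iff x^{-1}y\in P$, every two elements of $G$ having a common upper bound have a least upper bound $x\vee y$; write $x\vee y=\infty$ if there is no common upper bound. $(\mathbb Z,\mathbb N)^\infty$ is the direct sum of countably infinitely many copies of $(\mathbb Z,\mathbb N)$, $\mathbb N=\{0,1,2,\dots\}$, with coordinatewise order. Controlled map: an order-preserving homomorphism $\varphi:(G,P)\to(\mathcal G,\mathcal P)$ of quasi-lattice ordered groups such that (C1) the restriction $P\to\mathcal P$ is finite-to-one, and (C2) for all $x,y\in P$ with $x\vee y\neq\infty$, $\varphi(x)\vee\varphi(y)=\varphi(x\vee y)$. An atom of $P$ is an element $z\in P\setminus\{e\}$ such that $z=xy$ with $x,y\in P$ implies $x=e$ or $y=e$. When the set $S$ of atoms satisfies $P\setminus\{e\}=\bigcup_{s\in S}sP$ (automatic when a controlled map to $(\mathbb Z,\mathbb N)^\infty$ exists), the $\vee$-graph of $(G,P)$ has vertex set $S$ and edges $\{a,b\}$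 whenever $a\vee b=\infty$; $(G,P)$ is graph-irreducible if its $\vee$-graph is connected (connected graphs are understood to be nonempty). Nica spectrum: $\Omega$ is the set of $\omega\subset G$ with $e\in\omega$ that are hereditary ($\omega P^{-1}\subset\omega$) and directed ($x\vee y\ne\infty$ and $x\vee y\in\omega$ for $x,y\in\omega$), with the (compact Hausdorff) topology from $\{0,1\}^G$. $G$ acts partially on $\Omega$ by $\theta_t:U_{t^{-1}}\to U_t$, $\omega\mapsto t\omega$, where $U_t=\{\omega:t\in\omega\}$. $\partial\Omega$ is the closure in $\Omega$ of the set of maximal directed subsets of $G$ containing $e$ (equivalently, $\partial\Omega=\Omega_{\mathcal F}$ below). Let $\mathcal Q$ be the collection of finite subsets of $P$; for $\mathcal R\subset\mathcal Q$ put $\Omega_{\mathcal R}=\{\omega\in\Omega:\omega\cap tH\ne\emptyset\text{ for all }t\in\omega,\ H\in\mathcal R\}$. Put $\mathcal F=\{F\in\mathcal Q:\forall z\in P\ \exists x\in F,\ x\vee z\neq\infty\}$ and $\mathcal E=\{E\in\mathcal Q: P\setminus\bigcup_{x\in E}xP\text{ is finite}\}$. If $P$ has a finite set of lower bounds (a finite $T\subset P\setminus\{e\}$ with $P\setminus\{e\}=\bigcup_{s\in T}sP$), the essential spectrum is $\Omega_{\mathcal E}$; if $P$ has no finite set of lower bounds, the essential spectrum is all of $\Omega$ (and is also denoted $\Omega_{\mathcal E}$). For closed invariant $X\subset\Omega$, $C(X)\rtimes G$ is the full partial crossed product: the universal C*-completion of finite sums $\sum f_t\delta_t$, $f_t\in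 C_0(U_t\cap X)$, with $(f\delta_s)(g\delta_t)=\alpha_s(\alpha_{s^{-1}}(f)g)\delta_{st}$, $(f\delta_t)^*=\alpha_{t^{-1}}(\bar f)\delta_{t^{-1}}$, $\alpha_t(f)=f\circ\theta_{t^{-1}}$. $C^*(G,P):=C(\Omega)\rtimes G$. *)

(* Defs.v *)
From HB Require Import structures.
From Stdlib Require Export Relation_Operators.
From mathcomp Require Export all_boot all_order all_algebra.
From mathcomp Require Export all_classical all_reals all_analysis.
From mathcomp Require Export complex.

Set Implicit Arguments.
Unset Strict Implicit.
Unset Printing Implicit Defensive.

Import Order.TTheory GRing.Theory Num.Theory.
Import numFieldNormedType.Exports.

Local Open Scope classical_set_scope.
Local Open Scope ring_scope.

(** * Quasi-lattice ordered groups *)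

Section QuasiLattice.
Variables (G : groupType) (P : set G).

Definition ple (x y : G) : Prop := P (x^-1 * y)%g.

(* [x \/ y <> oo] *)
Definition bounded_pair (x y : G) : Prop := exists z, ple x z /\ ple y z.

(* [z = x \/ y] *)
Definition is_join (x y z : G) : Prop :=
  [/\ ple x z, ple y z & forall w, ple x w -> ple y w -> ple z w].

Record quasi_lattice_ordered : Prop := QuasiLatticeOrdered {
  qlo_one : P 1%g;
  qlo_mul : forall x y, P x -> P y -> P (x * y)%g;
  qlo_pos : forall x, P x -> P x^-1%g -> x = 1%g;
  qlo_join : forall x y, bounded_pair x y -> exists z, is_join x y z
}.

(* [x P] *)
Definition translate (x : G) (A : set G) : set G := [set (x * p)%g | p in A].

(** ** Atoms and the join graph *)

Definition atom (z : G) : Prop :=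
  [/\ P z, z <> 1%g &
      forall x y, P x -> P y -> z = (x * y)%g -> x = 1%g \/ y = 1%g].

Definition atoms : set G := [set z | atom z].

(* Loops never occur, since [a \/ a = a]. *)
Definition join_edge (a b : G) : Prop :=
  [/\ atom a, atom b & ~ bounded_pair a b].

Definition graph_irreducible : Prop :=
  atoms !=set0 /\
  forall a b, atom a -> atom b -> clos_refl_trans G join_edge a b.

End QuasiLattice.

(** ** Controlled maps *)

Record controlled (G H : groupType) (P : set G) (Q : set H)
    (phi : {multiplicative G -> H}) : Prop := Controlled {
  controlled_le : forall x y, ple P x y -> ple Q (phi x) (phi y);
  controlled_finite : forall q, Q q -> finite_set [set x | P x /\ phi x = q];
  controlled_join : forall x y z, P x -> P y ->
    is_join P x y z -> is_join Q (phi x) (phi y) (phi z)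
}.

(** ** The direct sum of countably many copies of (Z, N) *)

Definition finsupp_pred : {pred (nat -> int)} :=
  fun f => `[< finite_set [set i | f i <> 0] >].

Lemma finsupp_zmod_closed : zmod_closed finsupp_pred.
Proof.
split=> [|f g /asboolP ff /asboolP fg]; apply/asboolP.
  by rewrite (_ : [set _ | _] = set0) // -subset0 => i /=.
apply: (@sub_finite_set _ _ ([set i | f i <> 0] `|` [set i | g i <> 0])).
  move=> i /= fgi; have [fi0|fi0] := pselect (f i = 0); last by left.
  by right=> gi0; apply: fgi; rewrite !fctE fi0 gi0 subr0.
by rewrite finite_setU.
Qed.

HB.instance Definition _ :=
  GRing.isZmodClosed.Build (nat -> int) finsupp_pred finsupp_zmod_closed.

Record Zsum := MkZsum { Zsum_val :> nat -> int; _ : Zsum_val \in finsupp_pred }.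
HB.instance Definition _ := [isSub for Zsum_val].
HB.instance Definition _ := [Choice of Zsum by <:].
HB.instance Definition _ := [SubChoice_isSubZmodule of Zsum by <:].

(* The additive group [Zsum], written multiplicatively. *)
Definition Zinf : groupType := Algebra.to_multiplicative Zsum.

Definition Ninf : set Zinf := [set f : Zsum | forall i, 0 <= f i].

Lemma Ninf_quasi_lattice_ordered : quasi_lattice_ordered Ninf.
Proof.
have leE (f g : Zinf) : ple Ninf f g <-> forall i, (f : Zsum) i <= (g : Zsum) i.
  by split=> fg i; have := fg i; rewrite -[(f : Zsum) i <= _]subr_ge0 addrC.
split=> [i //|f g f0 g0 i|f f0 fN0|f g _].
- exact: addr_ge0 (f0 i) (g0 i).
- apply: val_inj; apply/funext => i; apply/eqP; rewrite eq_le.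
  by rewrite -oppr_ge0; apply/andP; split; [exact: (fN0 i)|exact: (f0 i)].
have fgfin : (fun i => Num.max ((f : Zsum) i) ((g : Zsum) i)) \in finsupp_pred.
  case: (f : Zsum) (g : Zsum) => [f' /= /asboolP ff] [g' /= /asboolP fg].
  apply/asboolP; have := conj ff fg; rewrite -finite_setU; apply: sub_finite_set.
  move=> i /= fgi; have [fi0|fi0] := pselect (f' i = 0); last by left.
  by right=> gi0; apply: fgi; rewrite fi0 gi0 maxxx.
exists (MkZsum fgfin); split; first by apply/leE => i /=; rewrite le_max lexx.
  by apply/leE => i /=; rewrite le_max lexx orbT.
move=> h /leE fh /leE gh; apply/leE => i /=.
by rewrite ge_max fh gh.
Qed.

(** * The Nica spectrum and its subspaces *)

(* A subset of [G] seen as a point of [{0,1}^G]. *)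
Notation point G := {ptws G -> bool}.

Section Spectrum.
Variables (G : groupType) (P : set G).
Implicit Types (w : point G).

Definition directed w : Prop :=
  forall x y, w x -> w y -> exists z, is_join P x y z /\ w z.

Definition hereditary w : Prop :=
  forall x p, w x -> P p -> w (x * p^-1)%g.

Definition Omega : set (point G) :=
  [set w : point G | [/\ w 1%g, hereditary w & directed w]].

Definition maximal_directed : set (point G) :=
  [set w : point G | [/\ w 1%g, directed w &
    forall v : point G, directed v -> (forall x, w x -> v x) -> v = w]].

Definition boundary : set (point G) := Omega `&` closure maximal_directed.

Definition spectrum_of (H : set (set G)) : set (point G) :=
  [set w : point G | Omega w /\ forall t F, w t -> H F ->
    ([set x | w x] `&` translate t F) !=set0].

Definition cofinite_family : set (set G) :=
  [set E | [/\ finite_set E, E `<=` P &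
    finite_set (P `\` \bigcup_(x in E) translate x P)]].

Definition has_finite_lower_bounds : Prop :=
  exists T : set G, [/\ finite_set T, T `<=` P `\ 1%g &
    P `\ 1%g = \bigcup_(s in T) translate s P].

Definition essential_spectrum : set (point G) :=
  if `[< has_finite_lower_bounds >] then spectrum_of cofinite_family
  else Omega.

(* [g] is in [t w] iff [t^-1 g] is in [w]. *)
Definition shift (t : G) w : point G := fun g => w (t^-1 * g)%g.

End Spectrum.

(** * C*-algebras (not necessarily unital) *)

Record cstarAlgebra (R : realType) := CStarAlgebra {
  cs_sort :> completeNormedModType R[i];
  cs_mul : cs_sort -> cs_sort -> cs_sort;
  cs_star : cs_sort -> cs_sort;
  cs_mulA : associative cs_mul;
  cs_mulDl : left_distributive cs_mul +%R;
  cs_mulDr : right_distributive cs_mul +%R;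
  cs_mulZl : forall (k : R[i]) x y, cs_mul (k *: x) y = k *: cs_mul x y;
  cs_mulZr : forall (k : R[i]) x y, cs_mul x (k *: y) = k *: cs_mul x y;
  cs_starD : {morph cs_star : x y / x + y};
  cs_starZ : forall (k : R[i]) x, cs_star (k *: x) = conjc k *: cs_star x;
  cs_starM : forall x y, cs_star (cs_mul x y) = cs_mul (cs_star y) (cs_star x);
  cs_starK : involutive cs_star;
  cs_normM : forall x y, `|cs_mul x y| <= `|x| * `|y|;
  cs_normC : forall x, `|cs_mul (cs_star x) x| = `|x| ^+ 2
}.

Record star_hom (R : realType) (A B : cstarAlgebra R) (q : A -> B) : Prop :=
  StarHom {
  star_homD : forall x y, q (x + y) = q x + q y;
  star_homZ : forall (k : R[i]) x, q (k *: x) = k *: q x;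
  star_homM : forall x y, q (cs_mul x y) = cs_mul (q x) (q y);
  star_hom_star : forall x, q (cs_star x) = cs_star (q x)
}.

Definition star_iso (R : realType) (A B : cstarAlgebra R) (q : A -> B) : Prop :=
  star_hom q /\ bijective q.

(** * Full partial crossed products *)

Section CrossedProduct.
Variables (R : realType) (G : groupType).
Local Notation C := (R[i]^o).

(* The formal sum [\sum_t a_t delta_t] is encoded by its coefficients
   [t |-> a_t]; a function on [U_t `&` X] is extended by zero to all of
   [{0,1}^G]. *)
Definition coeffs := G -> point G -> C.

(* Since [U_t] is clopen and [X] is compact, the zero extensions of functions in
   [C_0(U_t `&` X)] are the continuous functions on [X] that vanish off [U_t]. *)
Definition crossed_sums (X : set (point G)) : set coeffs :=
  [set a | [/\ finite_set [set t | a t <> (fun=> 0)],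
    forall t, {within X, continuous (a t : point G -> C)} &
    forall t w, ~ (X w /\ w t) -> a t w = 0]].

(* [alpha_t f = f \o theta_(t^-1)] on [U_t], extended by zero. *)
Definition alpha (t : G) (f : point G -> C) : point G -> C :=
  fun w => if w t then f (shift t^-1%g w) else 0.

Definition cp_add (a b : coeffs) : coeffs := fun t w => a t w + b t w.

Definition cp_scale (k : R[i]) (a : coeffs) : coeffs := fun t w => k * a t w.

(* Coefficient of [delta_r] in
   [\sum_(s, t) alpha_s (alpha_(s^-1) (a_s) b_t) delta_(s t)]. *)
Definition cp_mul (a b : coeffs) : coeffs := fun r w =>
  \sum_(s \in [set: G])
    alpha s (fun v => alpha s^-1%g (a s) v * b (s^-1 * r)%g v) w.

Definition cp_star (a : coeffs) : coeffs := fun t =>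
  alpha t (fun w => conjc (a t^-1%g w)).

Record cp_rep (X : set (point G)) (D : cstarAlgebra R) (p : coeffs -> D) : Prop :=
  CpRep {
  cp_repD : forall a b, crossed_sums X a -> crossed_sums X b ->
    p (cp_add a b) = p a + p b;
  cp_repZ : forall k a, crossed_sums X a -> p (cp_scale k a) = k *: p a;
  cp_repM : forall a b, crossed_sums X a -> crossed_sums X b ->
    p (cp_mul a b) = cs_mul (p a) (p b);
  cp_rep_star : forall a, crossed_sums X a -> p (cp_star a) = cs_star (p a)
}.

(* [A], with the canonical map [j], is [C(X) x| G]: the C*-algebra that is
   universal for *-homomorphisms from the *-algebra [crossed_sums X] to
   C*-algebras. The values of [j] and [p] off [crossed_sums X] are irrelevant. *)
Definition is_crossed_product (X : set (point G)) (A : cstarAlgebra R)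
    (j : coeffs -> A) : Prop :=
  cp_rep X j /\
  forall (D : cstarAlgebra R) (p : coeffs -> D), cp_rep X p ->
    exists! q : A -> D,
      star_hom q /\ forall a, crossed_sums X a -> q (j a) = p a.

(* Restriction of coefficients to [Y], inducing the canonical map
   [C(X) x| G -> C(Y) x| G] for [Y] contained in [X]. *)
Definition restrict_coeffs (Y : set (point G)) (a : coeffs) : coeffs :=
  fun t w => if `[< Y w >] then a t w else 0.

End CrossedProduct.

(* Main.v *)
Require Import Defs.

(** A point [w] of [Omega] is a limit of maximal directed sets as soon as, for
    each [t] in [w] and each finite [F] in [P \ {e}] with [w] disjoint from
    [t F], some [z] in [P] satisfies [z v x = oo] for all [x] in [F]: a maximal
    directed set through [t z] then avoids [t F]. Conversely, in a limit of
    maximal directed sets such a [z] is the only obstruction to meeting [t F].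
    So everything reduces to finding [z] whenever [P \ U_(x in F) x P] is
    infinite.

    If [x v s <> oo], write [x v s = s x']. A [z'] that works for the residuals
    [x'] yields [z = s z'] for [F], and since [phi x' = phi x v phi s - phi s],
    passing to residuals lowers the total degree of [F] unless [phi s] and
    [phi x] have disjoint supports for all [x] in [F]. An atom [s] keeping
    [P \ U x' P] infinite exists, so by induction on the degree one is left
    with an [F] from which some atom is separated in this sense; connectedness
    of the join graph propagates separation to all atoms, and an [x <> e] lies
    above some atom, so [F] must be empty. *)

Set Implicit Arguments.
Unset Strict Implicit.
Unset Printing Implicit Defensive.

Import Order.TTheory GRing.Theory Num.Theory.

Local Open Scope classical_set_scope.
Local Open Scope ring_scope.

(** * The order of a quasi-lattice ordered group *)

Section Order.
Variables (G : groupType) (P : set G).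
Hypothesis hP : quasi_lattice_ordered P.
Implicit Types x y z s : G.

Lemma ple_refl x : ple P x x.
Proof. by rewrite /ple mulVg; exact: qlo_one. Qed.

Lemma ple_trans x y z : ple P x y -> ple P y z -> ple P x z.
Proof. by move=> xy /(qlo_mul hP xy); rewrite -mulgA mulVKg. Qed.

Lemma ple_anti x y : ple P x y -> ple P y x -> x = y.
Proof.
move=> xy yx; apply/esym/(@mulgI _ x^-1%g); rewrite mulVg.
by apply: qlo_pos hP _ xy _; rewrite invgM invgK.
Qed.

Lemma ple_mul2l s x y : ple P (s * x)%g (s * y)%g = ple P x y.
Proof. by rewrite /ple invgM -mulgA mulKg. Qed.

Lemma ple1x x : ple P 1%g x = P x.
Proof. by rewrite /ple invg1 mul1g. Qed.

Lemma ple_mulr x p : ple P x (x * p)%g = P p.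
Proof. by rewrite /ple mulKg. Qed.

Lemma ple_divr x p : ple P (x / p)%g x = P p.
Proof. by rewrite /ple invgM invgK mulgVK. Qed.

Lemma is_join_fun x y z z' : is_join P x y z -> is_join P x y z' -> z = z'.
Proof.
move=> [xz yz minz] [xz' yz' minz'].
by apply: ple_anti; [exact: minz|exact: minz'].
Qed.

Lemma translateE x y : translate x P y <-> ple P x y.
Proof.
split=> [[p Pp <-]|xy]; first by rewrite ple_mulr.
by exists (x^-1 * y)%g => //; rewrite mulVKg.
Qed.

(** A common upper bound of [s * z] and [x] lies above [s], hence above the join [s * y]; cancel
    [s]. Contrapositively, if [z] avoids the residual [y], then [s * z] avoids [x]. *)
Lemma bounded_residual s z x y : is_join P s x (s * y)%g -> P z ->
  bounded_pair P (s * z)%g x -> bounded_pair P z y.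
Proof.
move=> [_ _ miny] Pz [w [szw xw]]; exists (s^-1 * w)%g.
split; rewrite -(ple_mul2l s) mulVKg //; apply: miny => //.
by apply: ple_trans szw; rewrite ple_mulr.
Qed.

End Order.

(** * Order, joins and total degree in the direct sum of copies of the integers *)

Section Weight.
Implicit Types f g : Zsum.

Lemma ple_NinfE (f g : Zinf) :
  ple Ninf f g <-> forall i, (f : Zsum) i <= (g : Zsum) i.
Proof.
by split=> fg i; have := fg i; rewrite -[(f : Zsum) i <= _]subr_ge0 addrC.
Qed.

(** The coordinatewise maximum is again finitely supported, so minimality of the join can be tested
    against it. *)
Lemma is_join_NinfE (f g h : Zinf) : is_join Ninf f g h ->
  forall i, (h : Zsum) i = Num.max ((f : Zsum) i) ((g : Zsum) i).
Proof.
move=> [fh gh minh] i; apply/eqP; rewrite eq_le; apply/andP; split; last first.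
  by rewrite ge_max; move/ple_NinfE: fh => ->; move/ple_NinfE: gh => ->.
have mfin : (fun i => Num.max ((f : Zsum) i) ((g : Zsum) i)) \in finsupp_pred.
  case: (f : Zsum) (g : Zsum) => [f' /= /asboolP ff] [g' /= /asboolP fg].
  apply/asboolP; have := conj ff fg; rewrite -finite_setU; apply: sub_finite_set.
  move=> j /= fgj; have [fj0|fj0] := pselect (f' j = 0); last by left.
  by right=> gj0; apply: fgj; rewrite fj0 gj0 maxxx.
have /ple_NinfE/(_ i)// : ple Ninf h (MkZsum mfin : Zinf).
by apply: minh; apply/ple_NinfE => j /=; rewrite le_max lexx ?orbT.
Qed.

Definition weight f : int := \sum_(i \in [set i | f i <> 0]) f i.

Lemma finite_Zsum f : finite_set [set i | f i <> 0].
Proof. by case: f => f /= /asboolP. Qed.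

Lemma weight_widen (A : set nat) f : (forall i, f i <> 0 -> A i) ->
  weight f = \sum_(i \in A) f i.
Proof. by move=> fA; apply: fsbig_widen => // i [_ /= /contrapT]. Qed.

Lemma weightD f g : weight (f + g) = weight f + weight g.
Proof.
pose A := [set i | f i <> 0] `|` [set i | g i <> 0].
have fA i : f i <> 0 -> A i by left.
have gA i : g i <> 0 -> A i by right.
have fgA i : (f + g) i <> 0 -> A i.
  move=> fgi; have [/fA//|/contrapT fi0] := pselect (f i <> 0).
  by right=> /= gi0; apply: fgi; rewrite -[RHS](addr0 0) -{1}fi0 -gi0.
rewrite (weight_widen fA) (weight_widen gA) (weight_widen fgA) -fsbig_split //.
by rewrite finite_setU; split; exact: finite_Zsum.
Qed.

Lemma weight_ge0 f : (forall i, 0 <= f i) -> 0 <= weight f.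
Proof. by move=> f0; apply: fsumr_ge0 => i _. Qed.

Lemma weight_eq0 f : (forall i, 0 <= f i) -> weight f = 0 -> f = 0.
Proof.
move=> f0 w0; apply: val_inj; apply/funext => i /=; apply: contrapT => fi0.
by apply: (fi0); apply: pfsumr_eq0 w0 _ _ => //; exact: finite_Zsum.
Qed.

End Weight.

(** * Degrees, atoms and residuals under a controlled map *)

Section Controlled.
Variables (G : groupType) (P : set G) (phi : {multiplicative G -> Zinf}).
Hypotheses (hP : quasi_lattice_ordered P) (hphi : controlled P Ninf phi).
Implicit Types (x y z s t : G) (F : seq G).

Let phiM x y : (phi (x * y)%g : Zsum) = (phi x : Zsum) + (phi y : Zsum).
Proof. exact: (@gmulfM _ _ phi x y). Qed.

Lemma controlled1 : (phi 1%g : Zsum) = 0.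
Proof. by apply: (addrI (phi 1%g : Zsum)); rewrite -phiM mulg1 addr0. Qed.

Let pos x (Px : P x) i : 0 <= (phi x : Zsum) i.
Proof.
have /(controlled_le hphi)/ple_NinfE/(_ i) : ple P 1%g x by rewrite ple1x.
by rewrite controlled1.
Qed.

Lemma expg_pos x n : P x -> P (x ^+ n)%g.
Proof.
move=> Px; elim: n => [|n IHn]; first exact: qlo_one hP.
by rewrite expgS; refine (qlo_mul hP Px IHn).
Qed.

(** If [x ^+ m] and [x ^+ n] agree with [m < n], then [x ^+ (n - m).-1] inverts [x], so that [x^-1]
    is positive too. *)
Lemma expg_inj x : P x -> x <> 1%g -> injective (fun n => x ^+ n)%g.
Proof.
move=> Px x1; suff lt m n : (m < n)%N -> (x ^+ m)%g <> (x ^+ n)%g.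
  by move=> m n; have [/lt//|/lt/nesym//|] := ltngtP m n.
move=> mn xmn; apply: x1; refine (qlo_pos hP Px _).
suff -> : x^-1%g = (x ^+ (n - m).-1)%g by refine (expg_pos _ Px).
apply: mulg1_eq; rewrite -expgS prednK ?subn_gt0 //.
by rewrite expgnFr ?(ltnW mn) // xmn mulgV.
Qed.

(** Otherwise the powers of [x] are infinitely many positive elements with image 0, against
    finiteness of the fibres. *)
Lemma controlled_eq1 x : P x -> (phi x : Zsum) = 0 -> x = 1%g.
Proof.
move=> Px x0; apply: contrapT => x1.
have fin : finite_set [set y | P y /\ (phi y : Zsum) = 0].
  by apply: controlled_finite hphi _ _ => i.
have := finite_preimage (in2W (expg_inj Px x1)) fin.
rewrite (_ : _ @^-1` _ = setT); first exact: infinite_nat.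
rewrite -subTset => n _; split; first by refine (expg_pos _ Px).
elim: n => [|n IHn]; first exact: controlled1.
by rewrite expgS phiM IHn x0 addr0.
Qed.

(** The absolute value makes inductions on the degree possible; on [P] it changes nothing, by
    [degE]. *)
Definition deg x : nat := absz (weight (phi x)).

Lemma degE x : P x -> (deg x)%:Z = weight (phi x).
Proof. by move=> Px; rewrite gez0_abs //; apply: weight_ge0; exact: pos. Qed.

Lemma degM x y : P x -> P y -> deg (x * y)%g = (deg x + deg y)%N.
Proof.
move=> Px Py; apply/eqP; rewrite -eqz_nat PoszD !degE //; last exact: qlo_mul.
by rewrite phiM weightD.
Qed.

Lemma deg_eq0 x : P x -> deg x = 0%N -> x = 1%g.
Proof.
move=> Px x0; apply: controlled_eq1 => //; apply: weight_eq0; first exact: pos.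
by rewrite -degE // x0.
Qed.

(** Induction on the degree: if [x] is not an atom, it splits as [a * b] with both factors
    nontrivial, and [a] has smaller degree because that of [b] is positive. *)
Lemma exists_atom_le x : P x -> x <> 1%g -> exists2 s, atom P s & ple P s x.
Proof.
have [n] := ubnP (deg x); elim: n x => // n IHn x xn Px x1.
have [ax|nax] := pselect (atom P x); first by exists x => //; exact: ple_refl.
have [a [b [Pa Pb xab a1 b1]]] :
    exists a b, [/\ P a, P b, x = (a * b)%g, a <> 1%g & b <> 1%g].
  apply: contrapT => nab; apply: nax; split => // a b Pa Pb xab.
  apply: contrapT => /not_orP[a1 b1]; apply: nab.
  by exists a, b.
have b0 : (0 < deg b)%N by rewrite lt0n; apply/eqP => /(deg_eq0 Pb).
have an : (deg a < n)%N.
  move: xn; rewrite xab degM // ltnS; apply: leq_trans.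
  by rewrite -[ltnLHS]addn0 ltn_add2l.
have [s sat sa] := IHn a an Pa a1.
by exists s => //; apply: ple_trans hP _ _ _ sa _; rewrite xab ple_mulr.
Qed.

(** This is what remains when the residual of [x] by [s] has the same degree as [x]; see
    [deg_residual_eq]. *)
Definition separated s x := forall i, (phi s : Zsum) i = 0 \/ (phi x : Zsum) i = 0.

Lemma separated_neq s x : P x -> x <> 1%g -> separated s x -> x <> s.
Proof.
move=> Px x1 sx xs; apply: x1; apply: controlled_eq1 => //.
by apply: val_inj; apply/funext => i /=; have [] := sx i; rewrite -?xs.
Qed.

Section Residual.
Variables (s x y : G).
Hypotheses (Ps : P s) (Px : P x) (sxy : is_join P s x (s * y)%g).

Lemma residual_pos : P y.
Proof. by case: sxy => + _ _; rewrite ple_mulr. Qed.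

Lemma phi_residual i :
  (phi y : Zsum) i =
  Num.max ((phi s : Zsum) i) ((phi x : Zsum) i) - (phi s : Zsum) i.
Proof.
have /is_join_NinfE <- := controlled_join hphi Ps Px sxy.
by rewrite phiM [RHS]addrC; apply/esym; exact: addKr.
Qed.

(** Wherever [phi x] vanishes, the maximum in [phi_residual] is [phi s], so [phi y] vanishes as
    well. *)
Lemma separated_residual t : separated t x -> separated t y.
Proof.
move=> tx i; have [|xi0] := tx i; [by left|right].
by rewrite phi_residual xi0 max_l ?subrr //; exact: pos.
Qed.

Let diff_ge0 i : 0 <= ((phi x : Zsum) - (phi y : Zsum)) i.
Proof.
suff : (phi y : Zsum) i <= (phi x : Zsum) i by rewrite -subr_ge0.
rewrite phi_residual lerBlDr ge_max lerDr lerDl; apply/andP.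
by split; exact: pos.
Qed.

Let weight_diff :
  weight ((phi x : Zsum) - (phi y : Zsum)) = (deg x)%:Z - (deg y)%:Z.
Proof.
rewrite (degE Px) (degE residual_pos); apply/eqP; rewrite eq_sym subr_eq.
by rewrite -weightD subrK.
Qed.

Lemma deg_residual_le : (deg y <= deg x)%N.
Proof.
rewrite -lez_nat -subr_ge0 -weight_diff.
by apply: weight_ge0; exact: diff_ge0.
Qed.

Lemma deg_residual_eq : deg y = deg x -> separated s x.
Proof.
move=> yx i.
(* A nonnegative difference of weight 0 vanishes, so [phi x = phi y]. Then [phi_residual] says that
   the maximum of two nonnegative coordinates is their sum, whence one of them is 0. *)
have := weight_eq0 diff_ge0; rewrite weight_diff yx subrr => /(_ erefl).
move=> /eqP; rewrite subr_eq0 => /eqP xy.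
have := phi_residual i; rewrite -xy => /eqP; rewrite eq_sym subr_eq eq_sym.
case: leP => _ /eqP e; [left|right]; apply/eqP.
  by rewrite -(inj_eq (addrI ((phi x : Zsum) i))) e addr0.
by rewrite -(inj_eq (addIr ((phi s : Zsum) i))) e add0r.
Qed.

(** A trivial residual would put [x] below the atom [s], leaving only [x = 1] or [x = s]. *)
Lemma residual_neq1 : atom P s -> x <> 1%g -> x <> s -> y <> 1%g.
Proof.
move=> [_ _ irr] x1 xs y1; case: sxy => _ + _; rewrite y1 mulg1 => le.
have [] := irr x (x^-1 * s)%g Px le; rewrite ?mulVKg // => e1; apply: xs.
by rewrite -[s](mulVKg x) e1 mulg1.
Qed.

End Residual.
End Controlled.

(** * Finding an element that has no join with any member of a finite set *)

Section Blocking.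
Variables (G : groupType) (P : set G) (phi : {multiplicative G -> Zinf}).
Hypotheses (hP : quasi_lattice_ordered P) (hphi : controlled P Ninf phi).
Implicit Types (x y z s t : G) (F : seq G).

Definition blockable F := exists2 z, P z & {in F, forall x, ~ bounded_pair P z x}.

Definition nontrivial F := {in F, forall x, P x /\ x <> 1%g}.

Definition total_deg F : nat := (\sum_(x <- F) deg phi x)%N.

Definition residual s x : option G :=
  if pselect (exists y, is_join P s x (s * y)%g) is left sx
  then Some (projT1 (cid sx)) else None.

Lemma residualE s x y : residual s x = Some y <-> is_join P s x (s * y)%g.
Proof.
rewrite /residual; case: pselect => [sx|nsx]; last first.
  by split=> // sxy; case: nsx; exists y.
case: (cid sx) => z /= sxz; split=> [[<-]//|sxy].
by congr Some; apply: (@mulgI _ s); exact: (is_join_fun hP sxz sxy).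
Qed.

(** Elements without a join with [s] drop out: every [s * z] with [z] in [P] already avoids them. *)
Definition residuals s F : seq G := pmap (residual s) F.

Lemma mem_residuals s F y :
  y \in residuals s F <-> exists2 x, x \in F & is_join P s x (s * y)%g.
Proof.
rewrite mem_pmap; split=> [/mapP[x xF /esym/residualE]|[x xF /residualE sxy]].
  by exists x.
by apply/mapP; exists x.
Qed.

Lemma bounded_residuals s F x : x \in F -> bounded_pair P s x ->
  exists2 y, y \in residuals s F & is_join P s x (s * y)%g.
Proof.
move=> xF /(qlo_join hP)[z sxz]; exists (s^-1 * z)%g; last by rewrite mulVKg.
by apply/mem_residuals; exists x; rewrite ?mulVKg.
Qed.

(** A dropped element loses its positive degree and a surviving one cannot gain any. Equality of the
    totals therefore means that nothing is dropped and each degree is kept, and [deg_residual_eq]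
    applies. *)
Lemma total_deg_residuals s F : P s -> nontrivial F ->
  (total_deg (residuals s F) <= total_deg F)%N /\
  (total_deg (residuals s F) = total_deg F ->
    {in F, forall x, bounded_pair P s x /\ separated phi s x}).
Proof.
move=> Ps; rewrite /total_deg; elim: F => [//|x F IHF] xF.
have [Px x1] := xF x (mem_head x F).
have {IHF} [le eq] : _ /\ _ := IHF (fun y yF => xF y (mem_behead (s := x :: F) yF)).
rewrite /residuals /=; case sx: (residual s x) => [y|] /=; rewrite !big_cons.
  have /residualE sxy := sx; have yx := deg_residual_le hphi Ps Px sxy.
  split=> [|e]; first by rewrite leq_add.
  have e' : deg phi y = deg phi x.
    apply/eqP; rewrite eqn_leq yx.
    by rewrite -(leq_add2r (\sum_(u <- residuals s F) deg phi u)) e leq_add2l.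
  move: e; rewrite e' => /addnI/eq sF u; rewrite inE => /orP[/eqP->|/sF//].
  split; last exact: (deg_residual_eq hphi Ps Px sxy e').
  by case: sxy => ssy xsy _; exists (s * y)%g.
split=> [|e]; first by rewrite (leq_trans le) // leq_addl.
have x0 : (0 < deg phi x)%N.
  by rewrite lt0n; apply/eqP => /(deg_eq0 hP hphi Px).
by move: le; rewrite e -[leqRHS]add0n leq_add2r leqNgt x0.
Qed.

Lemma blockable_residuals s F :
  P s -> blockable (residuals s F) -> blockable F.
Proof.
move=> Ps [z Pz zF']; exists (s * z)%g; first exact: (qlo_mul hP).
move=> x xF szx; have [|y yF' sxy] := bounded_residuals xF (s := s).
  case: szx => w [szw xw]; exists w; split=> //.
  by apply: (ple_trans hP) szw; rewrite ple_mulr.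
by apply: zF' yF' _; exact: (bounded_residual hP sxy Pz szx).
Qed.

Lemma nontrivial_residuals s F : atom P s -> s \notin F -> nontrivial F ->
  nontrivial (residuals s F).
Proof.
move=> sat sF F1 y /mem_residuals[x xF sxy]; have [Px x1] := F1 x xF.
have Ps : P s by case: sat.
split; first exact: (residual_pos sxy).
apply: (residual_neq1 Px sxy sat x1) => xs.
by rewrite -xs xF in sF.
Qed.

Section Connected.
Hypothesis hirr : graph_irreducible P.

(* When no atom lowers the degrees of F, an atom t separated from F has a join
   with every x in F. So an atom s with t v s = oo is not in F, its residuals
   are nontrivial and still separated from t, and minimality of the degree makes
   s separated from F. *)
Lemma separated_blockable F s : nontrivial F -> atom P s ->
  {in F, forall x, separated phi s x} -> blockable F.
Proof.
have [n] := ubnP (total_deg F); elim: n F s => // n IHn F s Fn F1 sat sF.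
apply: contrapT => nF.
have key t u : atom P t -> {in F, forall x, separated phi t x} ->
    atom P u -> u \notin F ->
    {in F, forall x, bounded_pair P u x /\ separated phi u x}.
  move=> tat tF uat uF; have Pu : P u by case: uat.
  have [] := total_deg_residuals Pu F1.
  (* If the degree drops, the induction hypothesis, with [t] as the separated atom, blocks the
     residuals and hence [F]. *)
  rewrite leq_eqVlt => /orP[/eqP e /(_ e)//|lt _]; exfalso; apply: nF.
  apply: (blockable_residuals Pu); apply: (IHn _ t) => //.
  - exact: leq_trans lt _.
  - exact: nontrivial_residuals.
  - move=> y /mem_residuals[x xF uxy]; have [Px _] := F1 x xF.
    exact: (separated_residual hphi Pu Px uxy (tF x xF)).
have bounded t : atom P t -> {in F, forall x, separated phi t x} ->
    {in F, forall x, bounded_pair P t x}.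
  (* A nontrivial element is never separated from itself, so [key] may be used with [u = t]. *)
  move=> tat tF x xF; have tnF : t \notin F.
    apply/negP => tinF; have [Pt t1] := F1 t tinF.
    exact: (separated_neq hP hphi Pt t1 (tF t tinF)).
  by have [] := key t t tat tF tat tnF x xF.
have step t u : join_edge P t u -> {in F, forall x, separated phi t x} ->
    {in F, forall x, separated phi u x}.
  move=> [tat uat tu] tF x xF; have unF : u \notin F.
    by apply/negP => /(bounded t tat tF).
  by have [] := key t u tat tF uat unF x xF.
have all t : atom P t -> {in F, forall x, separated phi t x}.
  move=> tat; have := hirr.2 s t sat tat => st.
  elim: st sF => {t tat s sat} [t u tu|//|t u v _ IH1 _ IH2]; first exact: step.
  by move=> /IH1/IH2.
case: F F1 nF {IHn Fn key bounded step sF} all => [|x F] F1 nF all.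
  by apply: nF; exists 1%g => //; exact: (qlo_one hP).
(* An atom [t] below [x] satisfies [phi t <= phi x]; being separated from [x], it has [phi t = 0],
   which is absurd. *)
have [Px x1] := F1 x (mem_head x F).
have [t tat tx] := exists_atom_le hP hphi Px x1.
have [Pt t1 _] := tat; apply: t1; apply: (controlled_eq1 hP hphi Pt).
apply: val_inj; apply/funext => i /=.
have /(controlled_le hphi)/ple_NinfE/(_ i) := tx.
have /(controlled_le hphi)/ple_NinfE/(_ i) : ple P 1%g t by rewrite ple1x.
rewrite (controlled1 phi) => t0 ti.
have [//|xi0] := all t tat x (mem_head x F) i.
by rewrite xi0 in ti; apply/eqP; rewrite eq_le; apply/andP.
Qed.

Definition uncovered F : set G := P `\` \bigcup_(x in [set` F]) translate x P.

Lemma uncovered_nontrivial F : {in F, forall x, P x} -> uncovered F !=set0 ->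
  nontrivial F.
Proof.
move=> FP [y [Py yF]] x xF; split; first exact: FP.
move=> x1; apply: yF; exists 1%g; first by rewrite /= -x1.
by apply/translateE; rewrite ple1x.
Qed.

(** An atom above a nontrivial [y] equals [y], so every atom outside [F] is uncovered. *)
Lemma infinite_atoms_uncovered F : infinite_set (atoms P) -> nontrivial F ->
  infinite_set (uncovered F).
Proof.
move=> infS F1; apply: (@sub_infinite_set _ (atoms P `\` [set` F])).
  move=> t [[Pt t1 irr] tF]; split=> // -[y yF /translateE yt].
  have [Py y1] := F1 y yF.
  have [] := irr y (y^-1 * t)%g Py yt; rewrite ?mulVKg // => e1.
  by apply: tF; rewrite /= -[t](mulVKg y) e1 mulg1.
exact: infinite_setD.
Qed.

Lemma infinite_uncovered_residuals F : infinite_set (uncovered F) ->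
  nontrivial F ->
  exists s, [/\ atom P s, nontrivial (residuals s F) &
    infinite_set (uncovered (residuals s F))].
Proof.
move=> infF F1.
have [finS|infS] := pselect (finite_set (atoms P)); last first.
  have [|s [sat sF]] := @infinite_setN0 _ (atoms P `\` [set` F]).
    exact: infinite_setD.
  have F'1 : nontrivial (residuals s F).
    by apply: nontrivial_residuals => //; exact/negP.
  by exists s; split=> //; exact: infinite_atoms_uncovered.
(* With finitely many atoms, [uncovered F] minus the identity is a finite union of the sets
   [s * quot s], so one of the [quot s] is infinite. *)
pose quot s := [set p | P p /\ uncovered F (s * p)%g].
have [s sat infs] : exists2 s, atom P s & infinite_set (quot s).
  apply: contrapT => nex; apply: infF.
  apply: (@sub_finite_set _ _
    ([set 1%g] `|` \bigcup_(s in atoms P) [set (s * p)%g | p in quot s])).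
    move=> x [Px xF]; have [->|x1] := pselect (x = 1%g); [by left|right].
    have [s sat sx] := exists_atom_le hP hphi Px x1; exists s => //.
    by exists (s^-1 * x)%g; rewrite ?mulVKg //; split; rewrite ?mulVKg.
  rewrite finite_setU; split; first exact: finite_set1.
  apply: bigcup_finite => // s sat; apply: finite_image; apply: contrapT => infs.
  by apply: nex; exists s.
(* If [p] lay above the residual [y] of [x], then [s * p] would lie above [s * y], hence above
   [x]. *)
have sub : quot s `<=` uncovered (residuals s F).
  move=> p [Pp [_ spF]]; split=> // -[y /mem_residuals[x xF sxy] /translateE yp].
  case: sxy => _ xsy _; apply: spF; exists x => //.
  by apply/translateE; apply: (ple_trans hP) xsy _; rewrite ple_mul2l.
have infF' := sub_infinite_set sub infs; exists s; split=> //.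
apply: uncovered_nontrivial => [y /mem_residuals[x xF]|]; first exact: residual_pos.
exact: infinite_setN0.
Qed.

Lemma infinite_uncovered_blockable F : {in F, forall x, P x} ->
  infinite_set (uncovered F) -> blockable F.
Proof.
have [n] := ubnP (total_deg F); elim: n F => // n IHn F Fn FP infF.
have F1 := uncovered_nontrivial FP (infinite_setN0 infF).
have [s [sat F'1 infF']] := infinite_uncovered_residuals infF F1.
have Ps : P s by case: sat.
have [le eq] := total_deg_residuals Ps F1.
(* If the degree stays the same, [s] itself is separated from all of [F]. *)
move: le; rewrite leq_eqVlt => /orP[/eqP/eq sepF|lt].
  by apply: separated_blockable F1 sat _ => x /sepF[].
apply: (blockable_residuals Ps); apply: IHn => //.
  exact: leq_trans lt _.
by move=> y /F'1[].
Qed.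

End Connected.
End Blocking.

(** * Closures in the topology of pointwise convergence *)

Lemma closure_pointP (G : groupType) (A : set (point G)) (w : point G) :
  closure A w <-> forall s : seq G, exists2 v, A v & {in s, v =1 w}.
Proof.
split=> [clA s|agree B nB].
  have nw : nbhs w [set v : point G | {in s, v =1 w}].
    elim: s => [|x s IHs]; first by apply: filterS filterT => v _ y.
    have nx : nbhs w [set v : point G | v x = w x].
      by apply: (@proj_continuous G (fun=> bool) x w [set w x]); exact: discrete_set1.
    apply: filterS (filterI nx IHs) => v [vx vs] y.
    by rewrite inE => /orP[/eqP->|/vs].
  by have [v [Av vw]] := clA _ nw; exists v.
(* The sets of points agreeing with [w] on a finite list form a filter base; its filter converges to
   [w] because it does so in each coordinate. *)
pose F := filter_from [set: seq G] (fun s => [set v : point G | {in s, v =1 w}]).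
have FF : Filter F.
  apply: filter_from_filter; first by exists [::].
  move=> s t _ _; exists (s ++ t) => // v vst.
  by split=> y ys; apply: vst; rewrite mem_cat ys ?orbT.
have Fw : F --> w.
  apply/cvg_sup => x C [D [[U oU <-] Uw UC]].
  exists [:: x] => // v vx; apply: UC; rewrite /preimage /=.
  by have := vx x; rewrite inE eqxx => /(_ isT) e; rewrite /proj /= e.
have [s _ sB] := Fw B nB; have [v Av vw] := agree s.
by exists v; split=> //; exact: sB.
Qed.

(** * Directed and maximal directed sets *)

Section Directed.
Variables (G : groupType) (P : set G).
Hypothesis hP : quasi_lattice_ordered P.
Implicit Types (w v : point G) (x y z t : G) (D : set G).

Lemma directed_bound w t (s : seq G) : directed P w -> w t ->
  {in s, forall x, w x} ->
  exists y, [/\ w y, ple P t y & {in s, forall x, ple P x y}].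
Proof.
move=> dw wt; elim: s => [|x s IHs] ws.
  by exists t; split=> //; exact: ple_refl.
have [|y [wy ty sy]] := IHs; first by move=> u us; apply: ws; rewrite inE us orbT.
have [z [[xz yz _] wz]] := dw x y (ws x (mem_head x s)) wy.
exists z; split=> //; first exact: (ple_trans hP ty yz).
by move=> u; rewrite inE => /orP[/eqP->//|/sy uy]; exact: (ple_trans hP uy yz).
Qed.

Definition lower_closure D : point G := fun x => `[< exists2 y, D y & ple P x y >].

Lemma lower_closure_directed D :
  (forall x y, D x -> D y -> exists z, [/\ D z, ple P x z & ple P y z]) ->
  directed P (lower_closure D).
Proof.
move=> dD x y /asboolP[x' Dx' xx'] /asboolP[y' Dy' yy'].
have [z [Dz x'z y'z]] := dD x' y' Dx' Dy'.
have xz := ple_trans hP xx' x'z; have yz := ple_trans hP yy' y'z.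
have [u [xu yu minu]] := qlo_join hP (ex_intro _ z (conj xz yz)).
exists u; split; first by split.
by apply/asboolP; exists z => //; exact: minu.
Qed.

(** The lower closure of [w] is directed and contains [w], so by maximality it is [w]. *)
Lemma maximal_directed_Omega w : maximal_directed P w -> Omega P w.
Proof.
move=> [w1 dw maxw]; split=> // x p wx Pp.
have -> : w = lower_closure [set u | w u].
  apply/esym/maxw => [|u wu]; last by apply/asboolP; exists u => //; exact: ple_refl.
  apply: lower_closure_directed => a b /= wa wb.
  by have [z [[az bz _] wz]] := dw a b wa wb; exists z.
by apply/asboolP; exists x => //; rewrite ple_divr.
Qed.

(** If [x] had a join with every member of [w], the lower closure of these joins would be a directed
    set containing [w] and [x], and maximality would put [x] into [w]. *)
Lemma maximal_directed_unbounded w x : maximal_directed P w -> ~ w x ->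
  exists2 y, w y & ~ bounded_pair P x y.
Proof.
move=> [w1 dw maxw] wx; apply: contrapT => nex.
have bnd y : w y -> exists z, is_join P x y z.
  by move=> wy; apply: (qlo_join hP); apply: contrapT => nb; apply: nex; exists y.
pose v := lower_closure [set z | exists2 y, w y & is_join P x y z].
have vw : v = w.
  apply: maxw => [|y wy].
    apply: lower_closure_directed => u u' [a wa [xa aa mina]] [b wb [xb bb minb]].
    have [c [[ac bc _] wc]] := dw a b wa wb; have [z [xz cz minz]] := bnd c wc.
    exists z; split; first by exists c.
      by apply: mina => //; exact: (ple_trans hP ac cz).
    by apply: minb => //; exact: (ple_trans hP bc cz).
  have [z xyz] := bnd y wy; apply/asboolP; exists z; first by exists y.
  by case: xyz.
have [z xz] := bnd _ w1; apply: wx; rewrite -vw.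
by apply/asboolP; exists z; [exists 1%g|case: xz].
Qed.

(** If [w] missed all [t * x], each would be unbounded with some member of [w]. A member [y] above
    [t] and these obstructions then yields the positive element [t^-1 * y], which avoids [F]. *)
Lemma maximal_directed_meets w t (F : seq G) : maximal_directed P w -> w t ->
  (forall z, P z -> exists2 x, x \in F & bounded_pair P z x) ->
  exists2 x, x \in F & w (t * x)%g.
Proof.
move=> mw wt FP; apply: contrapT => nex.
have dw : directed P w by case: mw.
have [y [wy ty nb]] : exists y, [/\ w y, ple P t y &
    {in F, forall x, ~ bounded_pair P y (t * x)%g}].
  have {nex FP} : {in F, forall x, ~ w (t * x)%g}.
    by move=> x xF wx; apply: nex; exists x.
  elim: F => [|x F IHF] nF; first by exists t; split=> //; exact: ple_refl.
  have [|y [wy ty nb]] := IHF; first by move=> u uF; apply: nF; rewrite inE uF orbT.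
  have [z wz nxz] := maximal_directed_unbounded mw (nF x (mem_head x F)).
  have [c [[yc zc _] wc]] := dw y z wy wz.
  exists c; split=> //; first exact: (ple_trans hP ty yc).
  move=> u; rewrite inE => /orP[/eqP-> [d [cd xd]]|/nb nyu [d [cd ud]]].
    by apply: nxz; exists d; split=> //; exact: (ple_trans hP zc cd).
  by apply: nyu; exists d; split=> //; exact: (ple_trans hP yc cd).
have [x xF [z [yz xz]]] := FP _ ty; apply: (nb x xF).
exists (t * z)%g; rewrite ple_mul2l; split=> //.
by rewrite -[y](mulVKg t) ple_mul2l.
Qed.

Lemma exists_maximal_directed x : P x -> exists2 w, maximal_directed P w & w x.
Proof.
move=> Px; pose bp D : point G := fun x => `[< D x >].
(* The union of the empty chain is empty, so [Q] must admit the empty set; a maximal [D] is nonempty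
   because the singleton of [x] satisfies [Q]. *)
pose Q D := directed P (bp D) /\ (D !=set0 -> D x).
have [|D [[dD D0] maxD]] := @Zorn_bigcup _ Q.
  move=> F FQ totF; split=> [a b /asboolP[A FA Aa] /asboolP[B FB Bb]|[a [A FA Aa]]].
    wlog AB : A B a b FA Aa FB Bb / A `<=` B.
      move=> H; have [AB|BA] := totF A B FA FB; first exact: (H A B).
      have [z [[bz az minz] uz]] := H B A b a FB Bb FA Aa BA.
      by exists z; split=> //; split=> // u au bu; exact: minz.
    have [|| z [abz /asboolP Bz]] := (FQ B FB).1 a b.
    - exact/asboolP/AB.
    - exact/asboolP.
    by exists z; split=> //; apply/asboolP; exists B.
  by exists A => //; apply: (FQ A FA).2; exists a.
have Dx : D x.
  apply: contrapT => nDx; apply: (maxD [set x]).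
    split=> [y Dy|sub]; first by case: nDx; apply: D0; exists y.
    by apply: nDx; exact: sub.
  split=> // a b /asboolP -> /asboolP ->; exists x; split; last exact/asboolP.
  by split=> //; exact: ple_refl.
have mD v : directed P v -> (forall y, bp D y -> v y) -> v = bp D.
  move=> dv Dv; apply/funext => y; apply/idP/idP => [vy|/Dv//].
  apply/asboolP; apply: contrapT => nDy; apply: (maxD [set u | v u]).
    split; first by move=> u Du; apply: Dv; exact/asboolP.
    by move=> sub; apply: nDy; exact: sub.
  split=> [a b /asboolP va /asboolP vb|_]; last by apply: Dv; exact/asboolP.
  by have [z [abz vz]] := dv a b va vb; exists z; split=> //; exact/asboolP.
exists (bp D); last exact/asboolP.
split=> //.
(* By maximality [D] is closed downwards, so it contains the identity, which lies below [x]. *)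
have -> : bp D = lower_closure D.
  apply/esym/mD => [|u /asboolP Du].
    apply: lower_closure_directed => a b Da Db.
    have [||z [[az bz _] /asboolP Dz]] := dD a b; [exact/asboolP..|].
    by exists z.
  by apply/asboolP; exists u => //; exact: ple_refl.
by apply/asboolP; exists x => //; rewrite ple1x.
Qed.

End Directed.

(** * The boundary spectrum and the essential spectrum *)

Section Spectra.
Variables (G : groupType) (P : set G).
Hypothesis hP : quasi_lattice_ordered P.
Implicit Types (w : point G) (x y z t : G) (F : seq G).

Lemma closure_maximal_directed w : Omega P w ->
  (forall t F, w t -> nontrivial P F -> {in F, forall x, ~ w (t * x)%g} ->
    blockable P F) ->
  closure (maximal_directed P) w.
Proof.
move=> [w1 hw dw] block; apply/closure_pointP => s.
have [t [wt Pt st]] : exists t, [/\ w t, ple P 1%g t &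
    {in [seq x <- s | w x], forall x, ple P x t}].
  by apply: directed_bound => // x; rewrite mem_filter => /andP[].
(* Here [t] in [w] dominates the part of [s] inside [w], and [F] collects the residuals by [t] of
   the part outside. By heredity [w] misses [t * F]: each of its elements lies above a point outside
   [w]. *)
rewrite ple1x in Pt; pose F := residuals P t [seq x <- s | ~~ w x].
have F1 : nontrivial P F /\ {in F, forall x, ~ w (t * x)%g}.
  suff FP : {in F, forall x, P x /\ ~ w (t * x)%g}.
    split=> x /FP[Px nx] //; split=> // x1.
    by apply: nx; rewrite x1 mulg1.
  move=> x /(mem_residuals hP)[y]; rewrite mem_filter => /andP[/negP nwy _] tyx.
  split; first exact: residual_pos tyx.
  case: tyx => _ yx _ wx; apply: nwy.
  have -> : y = (t * x / (y^-1 * (t * x)))%g by rewrite invgM invgK mulgA mulgV mul1g.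
  exact: hw.
have [z Pz zF] := block t F wt F1.1 F1.2.
have [v mv vtz] := exists_maximal_directed hP (qlo_mul hP Pt Pz).
have [v1 hv dv] := maximal_directed_Omega hP mv.
have vt : v t by rewrite -[t](mulgK z); exact: hv.
exists v => // x xs; case: (boolP (w x)) => wx.
  have tx : ple P x t by apply: st; rewrite mem_filter wx.
  have -> : x = (t / (x^-1 * t))%g by rewrite invgM invgK mulgA mulgV mul1g.
  exact: hv.
(* A point [x] of [s] outside [w] but in [v] would be bounded with [t * z], hence with [t], and [z]
   would be bounded with its residual in [F]. *)
apply/negP => vx; have [u [[xu tzu _] _]] := dv x (t * z)%g vx vtz.
have tu : ple P t u by apply: (ple_trans hP) tzu; rewrite ple_mulr.
have [||y yF txy] := bounded_residuals hP (s := t) (F := [seq x <- s | ~~ w x]) (x := x).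
- by rewrite mem_filter wx.
- by exists u.
apply: (zF y yF); apply: (bounded_residual hP txy Pz).
by exists u.
Qed.

Lemma boundary_meets w t F : boundary P w -> w t ->
  (forall z, P z -> exists2 x, x \in F & bounded_pair P z x) ->
  exists2 x, x \in F & w (t * x)%g.
Proof.
move=> [_ /closure_pointP clw] wt FP.
have [v mv vw] := clw (t :: [seq (t * x)%g | x <- F]).
have vt : v t by rewrite vw ?mem_head.
have [x xF vx] := maximal_directed_meets hP mv vt FP.
by exists x; rewrite // -vw // inE map_f ?orbT.
Qed.

(** The elements [z * s ^+ n] are pairwise distinct, so one of them is covered and lies above both
    [z] and some [x] in [F]. *)
Lemma finite_uncovered_meets F s : atom P s -> finite_set (uncovered P F) ->
  forall z, P z -> exists2 x, x \in F & bounded_pair P z x.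
Proof.
move=> [Ps s1 _] finF z Pz.
have [n nF] : exists n, ~ uncovered P F (z * s ^+ n)%g.
  apply: contrapT => /forallNP all; have inj : injective (fun n => z * s ^+ n)%g.
    by move=> m n /mulgI; exact: (expg_inj hP Ps s1).
  have := finite_preimage (in2W inj) finF.
  rewrite (_ : _ @^-1` _ = setT); first exact: infinite_nat.
  by rewrite -subTset => n _; apply: contrapT; exact: all.
have [x /= xF /translateE xz] : (\bigcup_(x in [set` F]) translate x P) (z * s ^+ n)%g.
  apply: contrapT => nx; apply: nF; split=> //.
  by refine (qlo_mul hP Pz (expg_pos hP n Ps)).
exists x => //; exists (z * s ^+ n)%g; rewrite ple_mulr; split=> //.
by refine (expg_pos hP n Ps).
Qed.

Section Controlled.
Variable phi : {multiplicative G -> Zinf}.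
Hypotheses (hphi : controlled P Ninf phi) (hirr : graph_irreducible P).

(** An atom above a nontrivial lower bound equals it, so a set of lower bounds contains all atoms;
    conversely the atoms are lower bounds by [exists_atom_le]. *)
Lemma finite_lower_boundsE :
  has_finite_lower_bounds P <-> finite_set (atoms P).
Proof.
split=> [[T [finT TP PT]]|finS].
  apply: sub_finite_set finT => s [Ps s1 irr].
  have : (P `\ 1%g) s by split.
  rewrite PT => -[t Tt /translateE ts]; have [Pt t1] := TP t Tt.
  have [] := irr t (t^-1 * s)%g Pt ts; rewrite ?mulVKg // => e1.
  by rewrite -[s](mulVKg t) e1 mulg1.
exists (atoms P); split=> //; first by move=> s [Ps s1 _]; split.
apply/seteqP; split=> x [].
  move=> Px x1; have [s sat sx] := exists_atom_le hP hphi Px x1.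
  by exists s => //; exact/translateE.
move=> s [Ps s1 _] [p Pp <-]; split; first exact: (qlo_mul hP).
move=> sp1; apply: s1; apply: (qlo_pos hP Ps).
by rewrite (mulg1_eq sp1).
Qed.

Lemma boundary_essential : boundary P = essential_spectrum P.
Proof.
rewrite /essential_spectrum; case: ifPn => /asboolP hfl; apply/seteqP; split.
- move=> w bw; split=> [|t E wt [/finite_seqP[F ->] FP finF]]; first by case: bw.
  have [[s sat] _] := hirr.
  have [x xF wx] := boundary_meets bw wt (finite_uncovered_meets sat finF).
  by exists (t * x)%g; split=> //; exists x.
- move=> w [Ow Ew]; split=> //; apply: closure_maximal_directed => // t F wt F1 nF.
  have FP : {in F, forall x, P x} by move=> x /F1[].
  (* Were [uncovered P F] finite, [F] would belong to [cofinite_family] and [w] would meet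
     [t * F]. *)
  apply: (infinite_uncovered_blockable hP hphi hirr FP) => finF.
  have [|x [wx [y yF tyx]]] := Ew t [set` F] wt.
    by split=> //; exact: finite_seq.
  by apply: (nF y yF); rewrite tyx.
- by move=> w [].
(* Without finite lower bounds there are infinitely many atoms, so [uncovered P F] is infinite for
   every nontrivial [F]. *)
- move=> w Ow; split=> //; apply: closure_maximal_directed => // t F wt F1 nF.
  apply: (infinite_uncovered_blockable hP hphi hirr); first by move=> x /F1[].
  apply: infinite_atoms_uncovered F1.
  by move/finite_lower_boundsE.
Qed.

End Controlled.
End Spectra.

(** * Uniqueness of the crossed product *)

Section CrossedProductUniqueness.
Variables (R : realType) (G : groupType) (X : set (point G)).

Lemma crossed_product_unique (A B : cstarAlgebra R)
    (jA : coeffs R G -> A) (jB : coeffs R G -> B) :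
  is_crossed_product X jA -> is_crossed_product X jB ->
  exists q : A -> B, star_iso q /\
    forall a, crossed_sums X a -> q (jA a) = jB a.
Proof.
move=> [repA uA] [repB uB].
have comp (C D E : cstarAlgebra R) (p : C -> D) (q : D -> E) :
    star_hom p -> star_hom q -> star_hom (q \o p).
  by move=> [? ? ? ?] [? ? ? ?]; split=> * /=; congruence.
have idh (C : cstarAlgebra R) : star_hom (@id C) by split.
have [q [[hq qj] _]] := uA B jB repB; have [r [[hr rj] _]] := uB A jA repA.
exists q; split=> //; split=> //; exists r.
  (* Both [r \o q] and the identity extend [jA] along itself, so uniqueness identifies them. *)
  have [i [_ ui]] := uA A jA repA.
  have rq : i = r \o q.
    by apply: ui; split=> [|a Xa /=]; [exact: comp|rewrite qj ?rj].
  have ii : i = id by apply: ui; split.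
  by move=> x; have := congr1 (fun f => f x) ii; rewrite rq.
have [i [_ ui]] := uB B jB repB.
have qr : i = q \o r.
  by apply: ui; split=> [|a Xa /=]; [exact: comp|rewrite rj ?qj].
have ii : i = id by apply: ui; split.
by move=> x; have := congr1 (fun f => f x) ii; rewrite qr.
Qed.

Lemma restrict_coeffs_id (a : coeffs R G) :
  crossed_sums X a -> restrict_coeffs X a = a.
Proof.
move=> [_ _ a0]; apply/funext => t; apply/funext => w; rewrite /restrict_coeffs.
by case: asboolP => // Xw; rewrite a0 // => -[].
Qed.

End CrossedProductUniqueness.

Theorem proposition6p4 (R : realType) (G : groupType) (P : set G)
    (hG : countable [set: G])
    (hGP : quasi_lattice_ordered P)
    (hphi : exists phi : {multiplicative G -> Zinf}, controlled P Ninf phi)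
    (hirr : graph_irreducible P) :
  boundary P = essential_spectrum P /\
  (infinite_set (atoms P) ->
    boundary P = Omega P /\
    (* the canonical map C*(G,P) -> C(boundary) x| G is an isomorphism *)
    forall (A B : cstarAlgebra R) (jA : coeffs R G -> A) (jB : coeffs R G -> B),
      is_crossed_product (Omega P) jA ->
      is_crossed_product (boundary P) jB ->
      exists q : A -> B, star_iso q /\
        forall a, crossed_sums (Omega P) a ->
          q (jA a) = jB (restrict_coeffs (boundary P) a)).
Proof.
have [phi cphi] := hphi; have bE := boundary_essential hGP cphi hirr.
split=> // infS; have bO : boundary P = Omega P.
  rewrite bE /essential_spectrum; case: ifPn => // /asboolP.
  by move/(finite_lower_boundsE hGP cphi).
(* Once the two spectra agree, restriction fixes every element of [crossed_sums], and the canonical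
   map is the comparison of two universal objects. *)
split=> // A B jA jB cA; rewrite bO => cB.
have [q [qiso qj]] := crossed_product_unique cA cB; exists q; split=> // a aO.
by rewrite restrict_coeffs_id // qj.
Qed.
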